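(* Let $(X,d)$ be an $f$-compact asymmetric space and let $T:X\to X$ be an $f$-shrinkage mapping, i.e. $d(Tx,Ty)<d(x,y)$ for all $x,y\in X$ with $x\neq y$. Suppose that $f$-convergence implies $b$-convergence in $X$. Then $T$ has a unique fixed point.
   Context: An asymmetric distance on a non-empty set $X$ is a function $d:X\times X\to\mathbb{R}$ such that for all $x,y,z\in X$: $d(x,y)\ge 0$; $d(x,y)=d(y,x)=0$ if and only if $x=y$; and $d(x,z)\le d(x,y)+d(y,z)$. (Symmetry is not required.) The pair $(X,d)$ is then called an asymmetric space. The forward topology $\tau^f$ on $X$ is generated by the base of balls $B^f(x,r)=\{u\in X: d(x,u)<r\}$, $x\in X$, $r>0$. The space $X$ is $f$-compact if every cover of $X$ by $\tau^f$-open sets has a finite subcover. A sequence $\{x_n\}$ $f$-converges to $x$ if $d(x,x_n)\to 0$, and $b$-converges to $x$ if $d(x_n,x)\to 0$. ''$f$-convergence implies $b$-convergence'' means that whenever $\{x_n\}$ $f$-converges to $x$, it also $b$-converges to $x$. *)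

(* Defs.v *)
From HB Require Import structures.
From mathcomp Require Import all_boot all_order all_algebra.
From mathcomp Require Import all_classical all_reals all_analysis.
Import Order.TTheory GRing.Theory Num.Theory.
Import numFieldNormedType.Exports.

Set Implicit Arguments.
Unset Strict Implicit.
Unset Printing Implicit Defensive.

Local Open Scope classical_set_scope.
Local Open Scope ring_scope.

HB.mixin Record isAsymmetricSpace (R : realType) (X : Type) := {
  adist : X -> X -> R ;
  aspace_nonempty : exists x : X, True ;
  adist_ge0 : forall x y, 0 <= adist x y ;
  adist_eq0 : forall x y, (adist x y = 0 /\ adist y x = 0) <-> x = y ;
  adist_triangle : forall x y z, adist x z <= adist x y + adist y z
}.

#[short(type="asymmetricSpaceType")]
HB.structure Definition AsymmetricSpace (R : realType) :=
  { X of isAsymmetricSpace R X }.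

Definition f_ball (R : realType) (X : asymmetricSpaceType R) (x : X) (r : R) :
  set X := [set u | adist x u < r].

Definition f_balls (R : realType) (X : asymmetricSpaceType R) : set (set X) :=
  [set A | exists x r, 0 < r /\ A = f_ball x r].
Arguments f_balls {R} X.

Section ForwardBase.
Variables (R : realType) (X : asymmetricSpaceType R).

Lemma adistxx (x : X) : adist x x = 0.
Proof. by have [_ /(_ erefl) []] := adist_eq0 x x. Qed.

Lemma f_balls_cover : \bigcup_(A in f_balls X) id A = setT.
Proof.
rewrite -subTset => x _; exists (f_ball x 1); first by exists x, 1.
by rewrite /f_ball /= adistxx.
Qed.

Lemma f_balls_join (A B : set X) (t : X) :
  f_balls X A -> f_balls X B -> id A t -> id B t ->
  exists C, [/\ f_balls X C, id C t & id C `<=` id A `&` id B].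
Proof.
move=> [x [r [_ ->]]] [y [s [_ ->]]]; rewrite /f_ball /= => xt yt.
exists (f_ball t (Num.min (r - adist x t) (s - adist y t))); split.
- exists t, (Num.min (r - adist x t) (s - adist y t)); split=> //.
  by rewrite lt_min !subr_gt0 xt yt.
- by rewrite /f_ball /= adistxx lt_min !subr_gt0 xt yt.
- move=> u; rewrite /f_ball /= lt_min !ltrBrDl => /andP[tr ts].
  by split; apply: le_lt_trans (adist_triangle _ t _) _.
Qed.

End ForwardBase.

(* A type alias of X: the topological structure declared on it is the forward
   one, so that [open], [cover_compact], ... on [forward X] refer to it. *)
Definition forward (R : realType) (X : asymmetricSpaceType R) : Type := X.

HB.instance Definition _ (R : realType) (X : asymmetricSpaceType R) :=
  gen_eqMixin (forward X).
HB.instance Definition _ (R : realType) (X : asymmetricSpaceType R) :=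
  gen_choiceMixin (forward X).
HB.instance Definition _ (R : realType) (X : asymmetricSpaceType R) :=
  isBaseTopological.Build (forward X)
    (@f_balls_cover R X) (@f_balls_join R X).

Definition f_compact (R : realType) (X : asymmetricSpaceType R) : Prop :=
  cover_compact [set: forward X].

Definition f_converges (R : realType) (X : asymmetricSpaceType R)
    (u : nat -> X) (x : X) : Prop :=
  adist x (u n) @[n --> \oo] --> (0 : R).

Definition b_converges (R : realType) (X : asymmetricSpaceType R)
    (u : nat -> X) (x : X) : Prop :=
  adist (u n) x @[n --> \oo] --> (0 : R).

Definition f_shrinkage (R : realType) (X : asymmetricSpaceType R)
    (T : X -> X) : Prop :=
  forall x y : X, x <> y -> adist (T x) (T y) < adist x y.

(* Main.v *)
Require Import Defs.
From mathcomp Require Import all_boot all_order all_algebra.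
From mathcomp Require Import all_classical all_reals all_analysis.
From mathcomp Require Import finmap.
Import Order.TTheory GRing.Theory Num.Theory.
Import numFieldNormedType.Exports.

Local Open Scope classical_set_scope.
Local Open Scope ring_scope.

(** The displacement [adist x (T x)] attains its minimum at some [x], and a
minimum must be a fixed point: if [T x <> x], then shrinking gives
[adist (T x) (T (T x)) < adist x (T x)], a smaller displacement at [T x].

The minimum exists because a real function with open strict superlevel sets
(a lower semicontinuous one) attains its infimum on a compact space
([cover_compact_has_min]).  For the displacement the semicontinuity follows
from
  [adist y (T y) <= adist y u + adist u (T u) + adist (T u) (T y)],
where the first and last terms are small when [u] is forward-close to [y].
For the first this is immediate.  For the last, [T] keeps [T u] forward-close
to [T y], and one must reverse the direction of the distance; this is where
forward convergence implying backward convergence enters, in the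
epsilon-delta form of [small_adist_sym]. *)

(** Without a minimum the sets [y : g x < g y], indexed by [x], would cover the
space, but the index at which [g] is least in a finite subcover would belong to
none of its members. *)
Lemma cover_compact_has_min (R : realType) (S : topologicalType) (g : S -> R) :
  (exists x : S, True) -> cover_compact [set: S] ->
  (forall c, open [set y | c < g y]) ->
  exists x, forall y, g x <= g y.
Proof.
move=> [x0 _] cS g_lsc; apply: contrapT => nomin.
have [] := cS S setT (fun x => [set y | g x < g y]).
- by move=> x _; exact: g_lsc.
- move=> y _; apply: contrapT => ny; apply: nomin; exists y => x.
  by rewrite leNgt; apply/negP => xy; apply: ny; exists x.
move=> D _ covD.
have [x xD _] := covD x0 I.
case: (arg_minP (fun i : D => g (val i)) (isT : predT [` xD]%fset)) => i _ mini.
have [j jD /=] := covD (val i) I.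
by rewrite ltNge (mini [` jD]%fset).
Qed.

Lemma open_forward (R : realType) (X : asymmetricSpaceType R)
    (A : set (forward X)) :
  (forall y, A y -> exists2 r, 0 < r & f_ball y r `<=` A) -> open A.
Proof.
move=> hA; exists [set B | f_balls X B /\ B `<=` A]; first by move=> B [].
apply/seteqP; split=> [y [B [_ BA] By]|y /hA[r r0 rA]]; first exact: BA.
exists (f_ball y r); first by split=> //; exists y, r.
by rewrite /f_ball /= adistxx.
Qed.

(** If no radius worked for [e], points chosen in the balls of radius
[1 / (n + 1)] would form a sequence that converges to [y] forward but not
backward. *)
Lemma small_adist_sym (R : realType) (X : asymmetricSpaceType R) :
  (forall (u : nat -> X) (x : X), f_converges u x -> b_converges u x) ->
  forall (y : X) (e : R), 0 < e ->
  exists2 r, 0 < r & forall u, adist y u < r -> adist u y < e.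
Proof.
move=> fb y e e0; apply: contrapT => nr.
have bad n : exists u, adist y u < n.+1%:R^-1 /\ e <= adist u y.
  apply: contrapT => nu; apply: nr; exists n.+1%:R^-1; first by rewrite invr_gt0.
  move=> u yu; rewrite ltNge; apply/negP => eu.
  by apply: nu; exists u.
have [u hu] := choice bad.
have : b_converges u y.
  apply: fb; apply: (@squeeze_cvgr _ _ _ _ (fun=> 0) (@harmonic R)).
  - by apply: nearW => n; rewrite adist_ge0 ltW //; case: (hu n).
  - exact: cvg_cst.
  - exact: cvg_harmonic.
move=> /cvgrPdist_lt /(_ e e0) [N _ /(_ N (leqnn N))] /=.
by rewrite sub0r normrN ger0_norm ?adist_ge0 // ltNge; case: (hu N) => _ ->.
Qed.

Lemma f_shrinkage_le (R : realType) (X : asymmetricSpaceType R) (T : X -> X) :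
  f_shrinkage T -> forall x y, adist (T x) (T y) <= adist x y.
Proof.
move=> shT x y; have [->|xy] := pselect (x = y); first by rewrite !adistxx.
exact/ltW/shT.
Qed.

(** The gap between [adist y (T y)] and [c] is shared equally between the two
error terms [adist y u] and [adist (T u) (T y)]. *)
Lemma open_displacement_gt (R : realType) (X : asymmetricSpaceType R)
    (T : X -> X) :
  f_shrinkage T ->
  (forall (u : nat -> X) (x : X), f_converges u x -> b_converges u x) ->
  forall c, open [set y : forward X | c < adist (y : X) (T y)].
Proof.
move=> shT fb c; apply: open_forward => y /= cy.
pose e := (adist (y : X) (T y) - c) / 2.
have e0 : 0 < e by rewrite divr_gt0 ?subr_gt0.
have [r r0 rP] := small_adist_sym R X fb (T y) e e0.
exists (Num.min e r); first by rewrite lt_min e0.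
move=> u; rewrite /f_ball /= lt_min => /andP[yue yur].
have Tue : adist (T u) (T y) < e.
  by apply: rP; apply: le_lt_trans yur; exact: f_shrinkage_le.
have /le_lt_trans : adist (y : X) (T y)
    <= adist (y : X) u + (adist (u : X) (T u) + adist (T u) (T y)).
  by rewrite (le_trans (adist_triangle _ u _)) // lerD2l adist_triangle.
move=> /(_ (e + (adist (u : X) (T u) + e))).
rewrite ltrD // ?ltrD2l // => /(_ isT).
by rewrite addrCA -splitr -ltrBlDr opprB addrC subrK.
Qed.

Theorem theorem21 (R : realType) (X : asymmetricSpaceType R) (T : X -> X) :
  f_compact X ->
  f_shrinkage T ->
  (forall (u : nat -> X) (x : X), f_converges u x -> b_converges u x) ->
  exists! x : X, T x = x.
Proof.
move=> cX shT fb.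
have [x minx] := cover_compact_has_min R (forward X)
  (fun y => adist (y : X) (T y)) aspace_nonempty cX
  (open_displacement_gt R X T shT fb).
have Tx : T x = x.
  apply: contrapT => nTx; have := minx (T x).
  by rewrite leNgt shT // => /esym.
exists x; split=> // y Ty; apply: contrapT => xy.
by have := shT x y xy; rewrite Tx Ty ltxx.
Qed.
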